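(* Let $q$ be a prime power, $n$ a positive integer, $L(x)=\sum_{i=0}^{n-1}a_ix^{q^{2i}}$ with $a_i\in\mathbb F_{q^{2n}}$. For $c\in\mathbb F_{q^2}$ let $N_c$ be the number of $u\in\mathbb F_{q^{2n}}$ with $\mathrm{Tr}(uL(u^q))+c=0$. Then \[N_0=q^{2(n-1)}+(q-1)q^{2(n-1)}\sum_{\upsilon\in U}(-q)^{-R(\upsilon)}\] and, for $c\in\mathbb F_{q^2}^*$, \[N_c=q^{2(n-1)}+q^{2n-1}(-q)^{-R(-c^{1-q})}-q^{2(n-1)}\sum_{\upsilon\in U}(-q)^{-R(\upsilon)}.\]
   Context: $\mathrm{Tr}$ is the trace $\mathbb F_{q^{2n}}\to\mathbb F_{q^2}$. $L^*(x)=\sum_{i=0}^{n-1}(a_i^qx)^{q^{2(n-i-1)}}$. $U$ is the subgroup of order $q+1$ of $\mathbb F_{q^2}^*$, and for $\upsilon\in U$, $R(\upsilon)=n-\dim\ker(\upsilon L^*+L)$, where the kernel is that of the induced $\mathbb F_{q^2}$-linear map on $\mathbb F_{q^{2n}}$ and the dimension is over $\mathbb F_{q^2}$. *)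

(* Defs.v *)
From HB Require Import structures.
From mathcomp Require Import all_boot all_order all_algebra falgebra fieldext finfield.
Set Implicit Arguments. Unset Strict Implicit. Unset Printing Implicit Defensive.
Import GRing.Theory.
Local Open Scope ring_scope.

(* Setting: F is the field F_{q^2}, L is an extension of F of dimension n,
   i.e. L = F_{q^{2n}}.  Elements of F are seen in L through c%:A. *)
Section Defs.
Variables (F : finFieldType) (L : fieldExtType F) (q n : nat).

(* trace F_{q^{2n}} -> F_{q^2} (values in L, they lie in F%:A) *)
Definition Tr (x : L) : L := \sum_(i < n) x ^+ (q ^ (2 * i)).

Definition Lpol (a : 'I_n -> L) (x : L) : L :=
  \sum_(i < n) a i * x ^+ (q ^ (2 * i)).

Definition Lstar (a : 'I_n -> L) (x : L) : L :=
  \sum_(i < n) (a i ^+ q * x) ^+ (q ^ (2 * (n - i - 1))).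

Definition Rk (a : 'I_n -> L) (v : F) : nat :=
  (n - \dim (lker (linfun (fun x : L => ((v%:A : L) * Lstar a x + Lpol a x)%R))))%N.

Definition Ncount (a : 'I_n -> L) (c : F) : nat :=
  #|[set u : finvect_type L | Tr (u * Lpol a (u ^+ q)) + c%:A == 0]|.

End Defs.

(* Main.v *)
Require Import Defs.
From HB Require Import structures.
From mathcomp Require Import all_boot all_order all_algebra falgebra fieldext finfield ring zify.
Set Implicit Arguments. Unset Strict Implicit. Unset Printing Implicit Defensive.
Import GRing.Theory Num.Theory.
Local Open Scope ring_scope.

(** Put [f u = Tr (u L(u^q)) = B(u, u)] with [B] sesquilinear over [F_{q^2}].  For
    [l != 0], [u |-> l f(u) + (l f(u))^q] is the diagonal of a Hermitian form which,
    since the adjoint of [L] is [L*], has radical [{w | (L + l^(q-1) L* )(w^q) = 0}].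
    The number of [l != 0] with [tr (l (f(u) + c)) = 0] is [q^2 - 1] if [f(u) + c = 0]
    and [q - 1] otherwise, so [N_c] follows by double counting once the fibres of a
    Hermitian form are known.

    For a Hermitian form [h] on a space of [T] elements with radical of size [R], all
    nonzero values are taken equally often, [M1] times, and zero [M0] times.  Counting
    the pairs with [h(u) = h(v)] gives [(M0 - M1)^2 = R T].  The sign of [M0 - M1] is
    found modulo [q + 1]: [M1] is divisible by [q + 1] because the norm-one group acts
    freely, and [- q = 1]. *)

(** * Counting fibres of maps between finite sets *)

(** The fibres cut [D] into at most [k] pieces of size at most [m], so a total of [m * k] forces
    equality. This turns bounds on numbers of roots into exact counts. *)
Lemma card_fiber_max (A B : finType) (D : {set A}) (Y : {set B}) (f : A -> B)
    (m k : nat) :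
  {in D, forall x, f x \in Y} ->
  {in Y, forall y, #|[set x in D | f x == y]| <= m}%N ->
  (#|Y| <= k)%N -> #|D| = (m * k)%N ->
  {in Y, forall y, #|[set x in D | f x == y]| = m}.
Proof.
move=> fY fm Yk cD y yY.
have cDE : #|D| = (\sum_(y in Y) #|[set x in D | f x == y]|)%N.
  rewrite -sum1_card (partition_big f [in Y]) //=.
  by apply: eq_bigr => z _; rewrite -sum1_card; apply: eq_bigl => x; rewrite inE.
apply/eqP; have [_] := leqif_sum (fun z zY => leqif_eq (fm z zY)).
suff -> : \sum_(i in Y) m = #|D| by rewrite -cDE eqxx => /esym/forall_inP; apply.
apply/eqP; rewrite eqn_leq {2}cDE leq_sum ?andbT => [|z]; last exact: fm.
by rewrite sum_nat_const cD mulnC leq_mul2l Yk orbT.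
Qed.

Lemma card_roots_lt (K : finFieldType) (p : {poly K}) :
  p != 0 -> (#|[set x | root p x]| < size p)%N.
Proof.
move=> p0; rewrite cardE; apply: max_poly_roots => //; last exact: enum_uniq.
by apply/allP => x; rewrite mem_enum inE.
Qed.

(** The power map sends the [m * k] units to the roots of [X^k - 1]. There are at most [k] such
    roots, and each fibre has at most [m] elements. *)
Lemma card_power_fiber (K : finFieldType) (m k : nat) (y : K) :
  #|K|.-1 = (m * k)%N -> y ^+ k = 1 -> #|[set x : K | x ^+ m == y]| = m.
Proof.
move=> cK yk.
have [m_gt0 k_gt0] : (0 < m /\ 0 < k)%N.
  by apply/andP; rewrite -muln_gt0 -cK -subn1 subn_gt0 finNzRing_gt1.
have roots j (z : K) : (0 < j)%N -> (#|[set x : K | x ^+ j == z]| <= j)%N.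
  move=> j_gt0; have szp : size ('X^j - z%:P : {poly K}) = j.+1 by rewrite size_XnsubC.
  rewrite -ltnS -szp (leq_ltn_trans _ (@card_roots_lt _ ('X^j - z%:P) _)) //.
    by rewrite subset_leq_card //; apply/subsetP => x; rewrite !inE rootE !hornerE subr_eq0.
  by rewrite -size_poly_eq0 szp.
(* As [m] and [k] are positive, [x^m = z] and [z^k = 1] force [x != 0], so only units are
   counted. *)
have sameset z : z ^+ k == 1 -> [set x : K | x ^+ m == z] = [set x in [set~ 0] | x ^+ m == z].
  move=> zk; apply/setP => x; rewrite !inE; case: (eqVneq x 0) => [->|] //.
  rewrite expr0n gtn_eqF //=; case: (eqVneq 0 z) => // z0; move: zk.
  by rewrite -z0 expr0n gtn_eqF // eq_sym oner_eq0.
rewrite sameset ?yk //.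
apply: (@card_fiber_max _ _ _ [set z : K | z ^+ k == 1] (fun x => x ^+ m) m k).
- move=> x; rewrite !inE => x0; rewrite -exprM -cK.
  rewrite -(inj_eq (mulfI x0)) mulr1 -exprS prednK ?expf_card //.
  exact: ltnW (finNzRing_gt1 K).
- by move=> z; rewrite inE => zk; rewrite -sameset // roots.
- exact: roots.
- by rewrite cardsC1.
- by rewrite inE yk.
Qed.

(** Translation by a difference of preimages embeds one fibre into another, so all fibres over [Y]
    have the same size. *)
Lemma card_additive_fiber (V W : finZmodType) (Y : {set W}) (g : V -> W) :
  {morph g : x y / x + y} -> (forall x, g x \in Y) ->
  (forall y, y \in Y -> exists x, g x = y) ->
  {in Y, forall y, (#|[set x | g x == y]| * #|Y|)%N = #|V|}.
Proof.
move=> gD gY gS.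
have fib y z : y \in Y -> z \in Y ->
    (#|[set x | g x == y]| <= #|[set x | g x == z]|)%N.
  move=> /gS[x gx] /gS[x' gx'].
  rewrite -(card_imset _ (addIr (x' - x))); apply/subset_leq_card/subsetP => t.
  case/imsetP => r; rewrite inE => /eqP gr ->.
  rewrite inE -(inj_eq (addIr (g x))) -gD -addrA subrK gD gr gx gx'.
  by rewrite addrC.
move=> y yY; rewrite mulnC -sum_nat_const -[RHS]cardsT -[RHS]sum1_card.
rewrite [RHS](partition_big g [in Y]) //=; apply: eq_bigr => z zY.
transitivity #|[set x | g x == z]|; last by rewrite -sum1_card; apply: eq_bigl => x; rewrite !inE.
by apply/eqP; rewrite eqn_leq !fib.
Qed.

(** * The field of [q^2] elements: conjugation, trace and norm *)

Section QuadraticField.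

Variables (K : finFieldType) (q : nat).
Hypothesis cardK : #|K| = (q ^ 2)%N.
Hypothesis conjD : {morph (fun x : K => x ^+ q) : x y / x + y}.

Lemma base_gt1 : (1 < q)%N.
Proof. by have := finNzRing_gt1 K; rewrite cardK; case: q => [|[]]. Qed.

Let q_gt0 : (0 < q)%N := ltnW base_gt1.

Lemma conjK (x : K) : (x ^+ q) ^+ q = x.
Proof. by rewrite -exprM -[(q * q)%N]/(q ^ 2)%N -cardK expf_card. Qed.

Lemma conj0 : 0 ^+ q = 0 :> K.
Proof. by rewrite expr0n gtn_eqF. Qed.

Lemma conjN (x : K) : (- x) ^+ q = - x ^+ q.
Proof. by apply/eqP; rewrite -addr_eq0 -conjD addNr conj0. Qed.

Lemma cardK_unit : #|K|.-1 = (q.-1 * q.+1)%N.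
Proof. by rewrite cardK -subn1 -[1%N](exp1n 2) subn_sqr subn1 addn1. Qed.

Definition base : {set K} := [set t | t ^+ q == t].

Lemma base0 : 0 \in base.
Proof. by rewrite inE conj0. Qed.

Lemma base_neq0P (t : K) : t != 0 -> (t ^+ q.-1 == 1) = (t \in base).
Proof. by move=> t0; rewrite inE -(inj_eq (mulfI t0)) -exprS prednK // mulr1. Qed.

Lemma card_base : #|base| = q.
Proof.
rewrite (cardsD1 0) base0 -[RHS](prednK q_gt0) add1n; congr _.+1.
rewrite -(card_power_fiber cardK_unit (expr1n K q.+1)); apply: eq_card => t.
rewrite !inE; case: eqVneq => [->|t0]; last by rewrite base_neq0P ?inE.
by rewrite [X in _ = (X == 1)]expr0n gtn_eqF ?ltn_predRL ?base_gt1 //= (eq_sym 0) oner_eq0.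
Qed.

Definition tr (x : K) : K := x + x ^+ q.

Lemma trD : {morph tr : x y / x + y}.
Proof. by move=> x y; rewrite /tr conjD addrACA. Qed.

Lemma tr_base (x : K) : tr x \in base.
Proof. by rewrite inE /tr conjD conjK addrC. Qed.

(** [X^q + X - s] has at most [q] roots, and [tr] maps [q^2] elements into a set of [q], so every
    fibre is full. *)
Lemma card_tr_fiber : {in base, forall t, #|[set x | tr x == t]| = q}.
Proof.
move=> t tB; have := @card_fiber_max _ _ [set: K] base tr q q.
move=> /(_ _ _ _ _ _ tB) <-; last 1 first.
- by rewrite cardsT cardK.
- by apply: eq_card => x; rewrite !inE.
- by move=> x _; apply: tr_base.
- move=> s _; have szp : size ('X^q + ('X - s%:P) : {poly K}) = q.+1.
    by rewrite size_polyDl size_polyXn // size_XsubC ltnS base_gt1.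
  rewrite -ltnS -szp; apply: leq_ltn_trans (@card_roots_lt _ ('X^q + ('X - s%:P)) _).
    apply/subset_leq_card/subsetP => x; rewrite !inE rootE !(hornerD, hornerN, hornerXn, hornerX, hornerC) => /eqP <-.
    by rewrite addrA [x ^+ q + x]addrC subrr.
  by rewrite -size_poly_eq0 szp.
- by rewrite card_base.
Qed.

(** A nonzero fixed point of conjugation is a [(q - 1)]-th root of unity, hence a [(q + 1)]-th
    power. *)
Lemma norm_surj (t : K) : t != 0 -> t \in base -> exists mu, mu ^+ q.+1 = t.
Proof.
move=> t0 tB; have : (0 < #|[set x : K | x ^+ q.+1 == t]|)%N.
  rewrite (@card_power_fiber _ _ q.-1) //; first by rewrite mulnC cardK_unit.
  by apply/eqP; rewrite base_neq0P.
by case/card_gt0P => mu; rewrite inE => /eqP; exists mu.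
Qed.

(** * Value distribution of a Hermitian form *)

Section Hermitian.

Variables (V : finLmodType K) (H : V -> V -> K).
Hypothesis HD : forall w, {morph H^~ w : u v / u + v}.
Hypothesis HZ : forall (x : K) u w, H (x *: u) w = x * H u w.
Hypothesis HC : forall u w, H w u = H u w ^+ q.

Definition radical : {set V} := [set w | [forall u, H u w == 0]].

Let M (s : K) := #|[set u | H u u == s]|.

Lemma herm_base u : H u u \in base.
Proof. by rewrite inE -HC. Qed.

Lemma herm_scale (x : K) u : H (x *: u) (x *: u) = x ^+ q.+1 * H u u.
Proof. by rewrite HZ HC HZ exprMn -HC mulrA -exprS. Qed.

Lemma hermD u w : H (u + w) (u + w) = H u u + H w w + tr (H u w).
Proof.
rewrite HD (HC _ u) (HC _ w) !HD !conjD -!HC /tr (HC u w).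
by ring.
Qed.

(** Scaling by some [mu] of norm [s] carries the vectors of value 1 bijectively to those of value
    [s]. *)
Lemma card_herm_eq (s : K) : s \in base -> s != 0 -> M s = M 1%R.
Proof.
move=> sB s0; have [mu muE] := norm_surj s0 sB.
have mu0 : mu != 0 by apply: contraNneq s0 => mu0; rewrite -muE mu0 exprS mul0r.
rewrite /M -(card_imset [set u | H u u == 1] (scalerI mu0)); apply: eq_card => u.
rewrite !inE; apply/eqP/imsetP => [Hu|[v]].
  exists (mu^-1 *: u); last by rewrite scalerA divff // scale1r.
  by rewrite inE herm_scale Hu -muE exprVn mulVf // expf_neq0.
by rewrite inE => /eqP Hv ->; rewrite herm_scale Hv mulr1.
Qed.

Lemma card_herm_total : #|V| = (M 0%R + q.-1 * M 1%R)%N.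
Proof.
rewrite -cardsT -sum1_card (partition_big (fun u => H u u) (fun s => s \in base)) /= => [|u _]; last exact: herm_base.
rewrite (bigD1 0 base0) /=; congr (_ + _)%N.
  by rewrite sum1dep_card; apply: eq_card => u; rewrite !inE.
rewrite (eq_bigr (fun=> M 1%R)) => [|s /andP[sB s0]].
  rewrite sum_nat_cond_const; congr (_ * _)%N.
  rewrite -card_base (cardsD1 0 base) base0 /=; apply: eq_card => s.
  by rewrite in_set in_setD1 andbC.
by rewrite sum1dep_card -(card_herm_eq sB s0); apply: eq_card => u; rewrite !inE.
Qed.

(** Rescaling a [v] with [H v w != 0] makes [H u w] take every value, so [u |-> tr (H u w)] is
    additive onto [base], with [q] equal fibres. *)
Lemma card_tr_herm (w : V) (t : K) : t \in base -> w \notin radical ->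
  (#|[set u | tr (H u w) == t]| * q)%N = #|V|.
Proof.
move=> tB; rewrite inE negb_forall => /existsP[v Hv0].
rewrite -[X in (_ * X)%N]card_base.
apply: (@card_additive_fiber V K base (fun u => tr (H u w))) => //.
- by move=> u u'; rewrite HD trD.
- by move=> u; apply: tr_base.
move=> s sB; have : (0 < #|[set x | tr x == s]|)%N by rewrite card_tr_fiber.
case/card_gt0P => x; rewrite inE => /eqP <-.
by exists ((x / H v w) *: v); rewrite HZ divfK.
Qed.

(* Both sides count the pairs [(u, v)] with [H u u = H v v]; on the right, [v = u + w]. *)
Lemma herm_second_moment :
  (q * (M 0%R * M 0%R + q.-1 * M 1%R * M 1%R))%N =
  (q * #|radical| * #|V| + (#|V| - #|radical|) * #|V|)%N.
Proof.
have -> : (M 0%R * M 0%R + q.-1 * M 1%R * M 1%R)%N = (\sum_(u : V) \sum_(v | H v v == H u u) 1)%N.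
  rewrite (eq_bigr (fun u => M (H u u))) => [|u _]; last first.
    by rewrite sum1dep_card; apply: eq_card => v; rewrite !inE.
  rewrite (bigID (fun u => H u u == 0)) /=; congr (_ + _)%N.
    rewrite (eq_bigr (fun=> M 0%R)) => [|u /eqP-> //].
    by rewrite sum_nat_const; congr (_ * _)%N; apply: eq_card => v; rewrite !inE.
  rewrite (eq_bigr (fun=> M 1%R)) => [|u]; last exact/card_herm_eq/herm_base.
  rewrite sum_nat_const; congr (_ * _)%N; apply/eqP.
  rewrite -(eqn_add2l (M 0%R)) -card_herm_total -(cardsC [set u | H u u == 0]) eqn_add2l.
  by apply/eqP/eq_card => u; rewrite !inE.
have -> : (\sum_(u : V) \sum_(v | H v v == H u u) 1 =
    \sum_(w : V) \sum_(u | (H w w + tr (H u w))%R == 0%R) 1)%N.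
  rewrite [RHS](exchange_big_dep xpredT) //=; apply: eq_bigr => u _.
  rewrite (reindex_inj (addrI u)) /=; apply: eq_bigl => w.
  by rewrite hermD -addrA -[LHS]subr_eq0 [_ - _]addrC addKr.
(* For [w] in the radical, [H w w] and [H u w] vanish and every [u] counts; any other [w]
   contributes [|V| / q], whence the factor [q]. *)
rewrite (bigID [in radical]) mulnDr /= -mulnA; congr (_ + _)%N.
  congr (_ * _)%N; rewrite -sum_nat_const; apply: eq_bigr => w.
  rewrite inE => /forallP wR; rewrite -cardsT -sum1_card; apply: eq_bigl => u.
  by rewrite !inE !(eqP (wR _)) /tr conj0 !addr0 eqxx.
rewrite big_distrr /= (_ : (#|V| - #|radical|)%N = #|[set w | w \notin radical]|); last first.
  by rewrite -(cardsC radical) addKn; apply: eq_card => w; rewrite !inE.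
rewrite -sum_nat_const; apply: eq_big => [w|w wR]; first by rewrite inE.
rewrite sum1dep_card -(@card_tr_herm w (- H w w)) 1?mulnC //; last first.
  by have := herm_base w; rewrite !inE conjN => /eqP->.
by congr (_ * _)%N; apply: eq_card => u; rewrite !inE addrC -addr_eq0.
Qed.

(* The norm-one group acts freely on the nonzero vectors and preserves [H u u]. *)
Lemma dvdn_card_herm : (q.+1 %| M 1%R)%N.
Proof.
pose U := [set x : K | x ^+ q.+1 == 1].
pose orb (u : V) := [set x *: u | x in U].
have cU : #|U| = q.+1.
  by rewrite (@card_power_fiber _ _ q.-1) ?expr1n // mulnC cardK_unit.
have U1 : 1 \in U by rewrite inE expr1n.
have orbZ x (u : V) : x \in U -> orb (x *: u) = orb u.
  move=> xU; have x0 : x != 0.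
    by apply: contraTneq xU => ->; rewrite inE exprS mul0r eq_sym oner_eq0.
  apply/setP => v; apply/imsetP/imsetP => [] [y yU ->].
    exists (y * x); last by rewrite scalerA.
    by move: xU yU; rewrite !inE exprMn => /eqP-> /eqP->; rewrite mulr1.
  exists (y / x); last by rewrite scalerA divfK.
  by move: xU yU; rewrite !inE exprMn exprVn => /eqP-> /eqP->; rewrite divr1.
rewrite /M (card_uniform_partition (n := q.+1) _ (preim_partitionP orb _)) => [|B]; first exact: dvdn_mull.
case/imsetP => u; rewrite inE => /eqP Hu ->.
have u0 : u != 0.
  apply: contra_eq_neq Hu => ->; rewrite -[0 : V](scale0r 0) HZ mul0r.
  by rewrite eq_sym oner_eq0.
rewrite -cU -(card_in_imset (f := fun x => x *: u) (D := U)).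
  apply: eq_card => v; rewrite !inE; apply/andP/imsetP => [[_ /eqP orbE]|[x xU ->]].
    by apply/imsetP; rewrite -/(orb u) orbE; apply/imsetP; exists 1; rewrite ?scale1r.
  by rewrite orbZ // herm_scale Hu mulr1; move: xU; rewrite inE.
move=> x y _ _ /eqP; rewrite -subr_eq0 -scalerBl scaler_eq0 (negPf u0) orbF subr_eq0.
by move/eqP.
Qed.

(** Obtained by solving [M 0 + (q - 1) M 1 = q^(2n)] and [M 0 - M 1 = (-q)^(n + d)]; the factor [q]
    avoids a division in the integers. *)
Lemma card_herm (n d : nat) (s : K) :
  #|V| = (q ^ (2 * n)%N)%N -> #|radical| = (q ^ (2 * d))%N -> s \in base ->
  q%:R * (M s)%:R =
    q%:R ^+ (2 * n)%N + (q%:R * (s == 0%R)%:R - 1) * (- q%:R) ^+ (n + d)%N :> int.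
Proof.
move=> cV cR sB; set E := (- q%:R) ^+ (n + d)%N.
have q1E : q.-1%:R = q%:R - 1 :> int by rewrite -subn1 natrB.
have q1_neq0 : q%:R - 1 != 0 :> int.
  by rewrite subr_eq0 pnatr_eq1 gtn_eqF // base_gt1.
have TE : q%:R ^+ (2 * n)%N = (M 0%R)%:R + (q%:R - 1) * (M 1%R)%:R :> int.
  by rewrite -natrX -cV card_herm_total natrD natrM q1E.
have S2 : ((M 0%R)%:R - (M 1%R)%:R) ^+ 2 = E ^+ 2 :> int.
  have le_RV : (#|radical| <= #|V|)%N by exact: max_card.
  have -> : E ^+ 2 = #|V|%:R * #|radical|%:R.
    by rewrite cV cR !natrX -exprD -mulnDr /E -exprM mulnC exprM sqrrN -exprM.
  have := congr1 (fun k : nat => k%:R : int) herm_second_moment.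
  rewrite /= !(natrD, natrM) natrB // q1E.
  have -> : #|V|%:R = (M 0%R)%:R + (q%:R - 1) * (M 1%R)%:R :> int by rewrite cV natrX TE.
  (* The two sides differ by [q - 1] times [(M 0 - M 1)^2 - |V| |radical|], and [q - 1] cancels. *)
  move=> /eqP; rewrite -subr_eq0 => /eqP eqM; apply: (mulfI q1_neq0).
  by apply: subr0_eq; rewrite -[RHS]eqM; ring.
have /dvdnP[k Mk] := dvdn_card_herm.
have -> : q%:R * (M s)%:R =
    q%:R ^+ (2 * n)%N + (q%:R * (s == 0%R)%:R - 1) * ((M 0%R)%:R - (M 1%R)%:R) :> int.
  rewrite TE; case: (eqVneq s 0) => [->|s0]; last by rewrite /= card_herm_eq //; ring.
  by rewrite /=; ring.
move/eqP: S2; rewrite eqf_sqr => /orP[/eqP-> //|/eqP SE].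
(* Modulo [q + 1] we have [- q = 1], and a sign error would make [q + 1] divide [2]. *)
have pow1 j : (q.+1%:Z %| (- q%:R) ^+ j - 1)%Z.
  rewrite subrX1 dvdz_mulr // -opprD dvdzE abszN /=.
  by rewrite -[1]/(1%:R) -natrD natz /= addn1.
have : (q.+1%:Z %| 2)%Z.
  (* The wrong sign gives [q M 1 = q^(2n) + E], where the left side is 0 and the right side 2 modulo
     [q + 1]. *)
  have -> : 2 = q%:R * (M 1%R)%:R - ((- q%:R) ^+ (2 * n)%N - 1) - (E - 1) :> int.
    have -> : E = (M 1%R)%:R - (M 0%R)%:R by rewrite -[LHS]opprK -SE opprB.
    by rewrite exprM sqrrN -exprM TE; ring.
  apply: rpredB; last exact: pow1.
  apply: rpredB; last exact: pow1.
  by rewrite Mk natrM mulrA dvdz_mull // natz.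
rewrite dvdzE /= => /dvdn_leq => /(_ isT); rewrite ltnS => q_le1.
by move: base_gt1; rewrite ltnNge q_le1.
Qed.

End Hermitian.
(** Multiplication by [x != 0] permutes the units, so the count is that of the nonzero elements of
    trace zero. *)
Lemma card_tr_ortho (x : K) :
  #|[set l : K | (l != 0) && (tr (l * x) == 0)]| =
  if x == 0 then (q ^ 2).-1 else q.-1.
Proof.
case: eqVneq => [->|x0].
  rewrite -cardK -(cardsC1 0); apply: eq_card => l.
  by rewrite !inE mulr0 /tr conj0 addr0 eqxx andbT.
rewrite -(card_tr_fiber base0) -(card_imset _ (mulIf x0)).
rewrite [in RHS](cardsD1 0) inE /tr conj0 addr0 eqxx /=; apply: eq_card => y.
rewrite !inE; apply/imsetP/andP => [[l]|[y0 try]].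
  by rewrite inE => /andP[l0 trl] ->; rewrite mulf_neq0.
by exists (y / x); rewrite ?inE divfK // mulf_neq0 ?invr_eq0.
Qed.

(** * Zeros of the diagonal of a sesquilinear form *)

Section Sesquilinear.

Variables (V : finLmodType K) (B : V -> V -> K).
Hypothesis BDl : forall w, {morph B^~ w : u v / u + v}.
Hypothesis BZl : forall (x : K) u w, B (x *: u) w = x * B u w.

Definition herm_part (l : K) (u w : V) : K := l * B u w + (l * B w u) ^+ q.

Hypothesis BDr : forall u, {morph B u : v w / v + w}.
Hypothesis BZr : forall (x : K) u w, B u (x *: w) = x ^+ q * B u w.

Lemma herm_partD l w : {morph (herm_part l)^~ w : u v / u + v}.
Proof. by move=> u v; rewrite /herm_part BDl BDr !mulrDr conjD addrACA. Qed.

Lemma herm_partZ l (x : K) u w : herm_part l (x *: u) w = x * herm_part l u w.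
Proof.
by rewrite /herm_part BZl BZr mulrDr mulrCA [l * (_ * B w u)]mulrCA exprMn conjK.
Qed.

Lemma herm_partC l u w : herm_part l w u = herm_part l u w ^+ q.
Proof. by rewrite /herm_part conjD conjK addrC. Qed.

Variables (n : nat) (d : K -> nat).
Hypothesis cardV : #|V| = (q ^ (2 * n))%N.
Hypothesis card_radical :
  forall l, l != 0 -> #|radical (herm_part l)| = (q ^ (2 * d (l ^+ q.-1)))%N.

Let N (c : K) := #|[set u | B u u + c == 0]|.

Let P (l c : K) := #|[set u | tr (l * (B u u + c)) == 0]|.

(** Since [tr (l * (B u u + c)) = herm_part l u u + tr (l * c)], the number [P l c] is a fibre size
    of a Hermitian form. *)
Lemma card_herm_part (l c : K) : l != 0 ->
  q%:R * (P l c)%:R =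
    q%:R ^+ (2 * n)%N
    + (q%:R * (tr (l * c) == 0%R)%:R - 1) * (- q%:R) ^+ (n + d (l ^+ q.-1))%N :> rat.
Proof.
move=> l0.
have <- : #|[set u | herm_part l u u == - tr (l * c)]| = P l c.
  by apply: eq_card => u; rewrite !inE mulrDr trD addr_eq0.
have := card_herm (herm_partD l) (herm_partZ l) (herm_partC l) cardV (card_radical l0).
move=> /(_ (- tr (l * c))) hE.
have /hE/(congr1 (intr : int -> rat)) : - tr (l * c) \in base.
  by have := tr_base (l * c); rewrite !inE conjN => /eqP->.
by rewrite oppr_eq0 !(rmorphD, rmorphM, rmorphB, rmorphN, rmorphXn, rmorph_nat, rmorph1) /=.
Qed.

(* Double counting of the pairs [(l, u)] with [l != 0] and [tr (l * (B u u + c)) = 0]. *)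
Lemma sum_card_herm_part (c : K) :
  \sum_(l : K | l != 0%R) (P l c)%:R =
  (q%:R - 1) * q%:R ^+ (2 * n)%N + (q%:R ^+ 2 - q%:R) * (N c)%:R :> rat.
Proof.
rewrite -natr_sum.
have -> : (\sum_(l : K | l != 0%R) P l c)%N =
    \sum_(u : V) #|[set l : K | (l != 0) && (tr (l * (B u u + c)) == 0)]|.
  under eq_bigr => l _ do rewrite /P -sum1dep_card.
  rewrite (exchange_big_dep xpredT) //=; apply: eq_bigr => u _.
  by rewrite sum1dep_card.
under eq_bigr => u _ do rewrite card_tr_ortho.
have -> : (\sum_(u : V) (if (B u u + c)%R == 0%R then (q ^ 2).-1 else q.-1) =
    q.-1 * #|V| + (q ^ 2 - q) * N c)%N.
  rewrite -[#|V|]cardsT mulnC (mulnC (_ - _)%N) -!sum_nat_const.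
  rewrite [X in (_ + X)%N](eq_bigl (fun u => B u u + c == 0)) => [|u]; last by rewrite inE.
  rewrite [X in (X + _)%N]big_mkcond [X in (_ + X)%N]big_mkcond -big_split /=; apply: eq_bigr => u _.
  rewrite inE; case: ifP => _; last by rewrite addn0.
  have qq : (q <= q ^ 2)%N by rewrite leq_pmulr.
  by rewrite addnC -!subn1 addnBA // subnK.
rewrite natrD !natrM cardV natrX -subn1 !natrB ?natrX //.
by rewrite leq_pmulr.
Qed.

(** The value of [P l c] depends on [l] only through [v = l^(q-1)], and each [v] of norm one comes
    from [q - 1] values of [l]. This collapses the sum in [sum_card_herm_part] to the norm-one
    group. *)
Lemma card_sesqui (c : K) :
  q%:R ^+ 2 * (N c)%:R =
    q%:R ^+ (2 * n)%N
    + \sum_(v : K | v ^+ q.+1 == 1%R)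
        (q%:R * ((c == 0%R) || (v == - (c / c ^+ q)))%:R - 1) *
        (- q%:R) ^+ (n + d v)%N :> rat.
Proof.
set S := \sum_(v | _) _.
have q1_neq0 : q%:R - 1 != 0 :> rat.
  by rewrite subr_eq0 pnatr_eq1 gtn_eqF // base_gt1.
pose G v := q%:R ^+ (2 * n)%N + (q%:R * ((c == 0%R) || (v == - (c / c ^+ q)))%:R - 1) *
        (- q%:R) ^+ (n + d v)%N : rat.
have GE (l : K) : l != 0 -> q%:R * (P l c)%:R = G (l ^+ q.-1).
  move=> l0; rewrite card_herm_part // /G; congr (_ + (_ * (nat_of_bool _)%:R - 1) * _).
  case: (eqVneq c 0) => [->|c0] /=; first by rewrite mulr0 /tr conj0 addr0 eqxx.
  have cq0 : c ^+ q != 0 by rewrite expf_neq0.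
  (* Dividing [l c + (l c)^q = 0] by [l c^q] gives [l^(q-1) = - c / c^q]. *)
  rewrite /tr addrC exprMn addr_eq0 -[in RHS](inj_eq (mulfI l0)) -exprS prednK //.
  by rewrite -[in RHS](inj_eq (mulIf cq0)) -mulrA mulNr divfK // mulrN.
have sumG : \sum_(l : K | l != 0) G (l ^+ q.-1) =
    (q%:R - 1) * \sum_(v : K | v ^+ q.+1 == 1) G v.
  rewrite (partition_big (fun l => l ^+ q.-1) (fun v => v ^+ q.+1 == 1)) /=; last first.
    move=> l l0; rewrite -exprM -cardK_unit -(inj_eq (mulfI l0)) mulr1 -exprS.
    by rewrite prednK ?expf_card // ltnW // finNzRing_gt1.
  rewrite big_distrr /=; apply: eq_bigr => v /eqP v1.
  rewrite (eq_bigr (fun=> G v)) => [|l /andP[_ /eqP->] //].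
  rewrite sumr_const -[LHS]mulr_natl; congr (_ * _).
  rewrite -[1](mulr1n 1) -natrB // subn1; congr (_%:R).
  rewrite -[RHS](card_power_fiber cardK_unit v1); apply: eq_card => l.
  rewrite inE unfold_in andbC; case: eqP => //= lv; apply/eqP => l0; move/eqP: v1.
  have q1 : (0 < q.-1)%N by rewrite ltn_predRL base_gt1.
  by rewrite -lv l0 -exprM expr0n muln_eq0 gtn_eqF // (eq_sym 0) oner_eq0.
have cU : #|[pred v : K | v ^+ q.+1 == 1]| = q.+1.
  rewrite -[RHS](@card_power_fiber K q.+1 q.-1 1) ?expr1n 1?mulnC ?cardK_unit //.
  by apply: eq_card => v; rewrite !inE.
have := congr1 (fun x => q%:R * x) (sum_card_herm_part c).
rewrite big_distrr /= (eq_bigr _ (fun l l0 => GE l l0)) sumG /G big_split /= -/S.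
rewrite sumr_const cU -[X in X + S](mulr_natl _ q.+1) -natr1 => eqS.
apply: (mulfI q1_neq0).
(* The sum over the [q + 1] elements of norm one contains [q + 1] copies of [q^(2n)]; the double
   count removes [q] of them. *)
have -> : (q%:R - 1) * (q%:R ^+ 2 * (N c)%:R) =
    q%:R * ((q%:R - 1) * q%:R ^+ (2 * n)%N + (q%:R ^+ 2 - q%:R) * (N c)%:R)
    - q%:R * (q%:R - 1) * q%:R ^+ (2 * n)%N :> rat by ring.
by rewrite -eqS; ring.
Qed.

End Sesquilinear.
End QuadraticField.

(** * Frobenius maps, the trace of [L] over [F], and the adjoint of a linearized polynomial *)

Lemma frobenius_add (R : comNzRingType) (p k : nat) :
  p \in [pchar R] -> {morph (fun x : R => x ^+ (p ^ k)) : x y / x + y}.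
Proof.
move=> pR x y; apply: exprDn_pchar.
by rewrite pnatX pnatE ?(pcharf_prime pR) ?pR.
Qed.

Lemma expf_card_iter (K : finFieldType) (i : nat) (x : K) : x ^+ (#|K| ^ i) = x.
Proof. by elim: i => [|i IHi]; rewrite ?expr1 // expnSr exprM IHi expf_card. Qed.

(** [X^|F| - X] is the product of all [X - c] with [c] in [F]; evaluated at [x], some factor must
    vanish. *)
Lemma fixed_in_alg (F : finFieldType) (L : fieldExtType F) (x : L) :
  x ^+ #|F| = x -> exists c : F, x = c%:A.
Proof.
move=> xF; have := congr1 (map_poly (in_alg L)) (finField_genPoly F).
rewrite rmorphB rmorph_prod /= map_polyXn map_polyX.
move/(congr1 (fun p : {poly L} => p.[x])).
rewrite hornerD hornerN hornerXn hornerX xF subrr horner_prod => /esym/eqP.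
case/prodf_eq0 => c _; rewrite rmorphB /= map_polyX map_polyC hornerXsubC subr_eq0.
by move/eqP; exists c.
Qed.

Section FieldExtension.

Variables (F : finFieldType) (L : fieldExtType F) (p k n : nat) (a : 'I_n -> L).
Hypothesis p_prime : prime p.
Let q := (p ^ k)%N.
Hypothesis cardF : #|F| = (q ^ 2)%N.
Hypothesis n_gt0 : (0 < n)%N.
Hypothesis dimL : \dim {: L} = n.

Let Tr := @Tr F L q n.
Let Lp := Lpol q a.
Let Ls := Lstar q a.

Lemma pcharF : p \in [pchar F].
Proof. by apply: (@card_finPcharP _ _ (k * 2)) => //; rewrite cardF /q expnM. Qed.

Lemma card_ext : #|finvect_type L| = (q ^ (2 * n))%N.
Proof. rewrite expnM -cardF -dimL -(card_vspace (fullv : {vspace finvect_type L})).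
by rewrite card_vspacef. Qed.

Lemma frobD (j : nat) : {morph (fun x : L => x ^+ (q ^ j)) : x y / x + y}.
Proof.
by move=> x y; rewrite /q -expnM; apply: frobenius_add; rewrite pchar_lalg pcharF.
Qed.

Lemma conjD_base : {morph (fun x : F => x ^+ q) : x y / x + y}.
Proof. by move=> x y; apply: frobenius_add pcharF _ _. Qed.

Lemma conjD_ext : {morph (fun x : L => x ^+ q) : x y / x + y}.
Proof. by have := frobD 1; rewrite expn1. Qed.

Let q_gt1 : (1 < q)%N := base_gt1 cardF.

Lemma qX_gt0 (j : nat) : (0 < q ^ j)%N.
Proof. by rewrite expn_gt0 ltnW. Qed.

Lemma frob0 (j : nat) : 0 ^+ (q ^ j) = 0 :> L.
Proof. by rewrite expr0n gtn_eqF ?qX_gt0. Qed.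

Lemma frob_scalar (i : nat) (c : F) : c%:A ^+ (q ^ (2 * i)) = c%:A :> L.
Proof. by rewrite -in_algE -rmorphXn /= expnM -cardF expf_card_iter. Qed.

Lemma frob_scale (i : nat) (c : F) (x : L) :
  (c *: x) ^+ (q ^ (2 * i)) = c *: x ^+ (q ^ (2 * i)).
Proof. by rewrite -[c *: x]mulr_algl exprMn frob_scalar mulr_algl. Qed.

Lemma conj_scale (c : F) (x : L) : (c *: x) ^+ q = c ^+ q *: x ^+ q.
Proof. by rewrite -[c *: x]mulr_algl exprMn -in_algE -rmorphXn /= mulr_algl. Qed.

Lemma frob_ext (x : L) : x ^+ (q ^ (2 * n)) = x.
Proof. by rewrite -card_ext (@expf_card (finvect_type L)). Qed.

Lemma frob_sum (j : nat) (I : finType) (f : I -> L) :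
  (\sum_i f i) ^+ (q ^ j) = \sum_i f i ^+ (q ^ j).
Proof. exact: (big_morph _ (frobD j) (frob0 j)). Qed.

Lemma conj_sum (I : finType) (f : I -> L) : (\sum_i f i) ^+ q = \sum_i f i ^+ q.
Proof. by have := frob_sum 1 f; rewrite expn1. Qed.

Lemma TrD : {morph Tr : x y / x + y}.
Proof.
by move=> x y; rewrite /Tr /Defs.Tr -big_split; apply: eq_bigr => i _; rewrite /= frobD.
Qed.

Lemma TrZ (c : F) (x : L) : Tr (c *: x) = c *: Tr x.
Proof.
by rewrite /Tr /Defs.Tr scaler_sumr; apply: eq_bigr => i _; rewrite frob_scale.
Qed.

Lemma Tr0 : Tr 0 = 0.
Proof. by have := TrZ 0 0; rewrite !scale0r. Qed.

Lemma Tr_sum (I : finType) (f : I -> L) : Tr (\sum_i f i) = \sum_i Tr (f i).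
Proof. exact: (big_morph _ TrD Tr0). Qed.

(** Raising to the power [q^2] shifts the terms of the trace cyclically, the last one wrapping round
    by [frob_ext]. *)
Lemma Tr_frob2 (x : L) : Tr (x ^+ (q ^ 2)) = Tr x.
Proof.
rewrite /Tr /Defs.Tr; case: n n_gt0 frob_ext => // m _ xm.
rewrite big_ord_recr big_ord_recl /= addrC -exprM -expnD -mulnS xm muln0 expr1.
congr (_ + _); apply: eq_bigr => i _.
by rewrite -exprM -expnD mulnS.
Qed.

Lemma Tr_frob (j : nat) (x : L) : Tr (x ^+ (q ^ (2 * j))) = Tr x.
Proof.
elim: j x => [|j IHj] x; first by rewrite muln0 expr1.
by rewrite mulnS expnD exprM IHj Tr_frob2.
Qed.

Lemma conj_Tr (x : L) : Tr x ^+ q = Tr (x ^+ q).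
Proof.
rewrite conj_sum; apply: eq_bigr => i _.
by rewrite -!exprM mulnC.
Qed.

Lemma Tr_scalar (x : L) : exists c : F, Tr x = c%:A.
Proof. by apply: fixed_in_alg; rewrite cardF expnS expn1 exprM !conj_Tr -exprM Tr_frob2. Qed.

(** If [y != 0], taking [u = x / y] makes the trace vanish on all of [L], yet it is a polynomial of
    degree [q^(2(n-1))], less than [|L|]. *)
Lemma Tr_nondegenerate (y : L) : (forall u, Tr (u * y) = 0) -> y = 0.
Proof.
move=> Try; apply: contraTeq isT => y0.
pose P : {poly finvect_type L} := \sum_(i < n) 'X^(q ^ (2 * i)).
have szP : size P = (q ^ (2 * n.-1)).+1.
  rewrite /P; case: n n_gt0 => // m _; rewrite big_ord_recr /= addrC.
  rewrite size_polyDl size_polyXn // ltnS; apply: leq_trans (size_sum _ _ _) _.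
  apply/bigmax_leqP => i _; rewrite size_polyXn ltn_exp2l //.
  by rewrite ltn_mul2l ltn_ord.
have P0 : P != 0 by rewrite -size_poly_eq0 szP.
have := card_roots_lt P0; rewrite szP ltnS leqNgt => /negP[].
rewrite (_ : [set x | root P x] = [set: finvect_type L]).
  by rewrite cardsT card_ext ltn_exp2l // ltn_mul2l ltn_predL.
apply/setP => x; rewrite !inE /root horner_sum; apply/eqP.
rewrite -[RHS](Try (x / y)) divfK //; apply: eq_bigr => i _.
by rewrite hornerXn.
Qed.

Lemma LpD : {morph Lp : x y / x + y}.
Proof.
move=> x y; rewrite /Lp /Lpol -big_split; apply: eq_bigr => i _.
by rewrite /= frobD mulrDr.
Qed.

Lemma LpZ (c : F) (x : L) : Lp (c *: x) = c *: Lp x.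
Proof.
by rewrite /Lp /Lpol scaler_sumr; apply: eq_bigr => i _; rewrite frob_scale scalerAr.
Qed.

Lemma LsD : {morph Ls : x y / x + y}.
Proof.
move=> x y; rewrite /Ls /Lstar -big_split; apply: eq_bigr => i _.
by rewrite /= mulrDr frobD.
Qed.

Lemma LsZ (c : F) (x : L) : Ls (c *: x) = c *: Ls x.
Proof.
rewrite /Ls /Lstar scaler_sumr; apply: eq_bigr => i _.
by rewrite -scalerAr frob_scale.
Qed.

(** Termwise, raising to the power [q^(2(n-i-1))] preserves the trace and turns [u^(q^(2i+2))] into
    [u^(q^(2n)) = u]. *)
Lemma Tr_adjoint (u w : L) : Tr (w * Lp (u ^+ q)) ^+ q = Tr (u * Ls (w ^+ q)).
Proof.
rewrite conj_Tr exprMn /Lp /Lpol conj_sum mulr_sumr Tr_sum.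
rewrite /Ls /Lstar mulr_sumr Tr_sum; apply: eq_bigr => i _.
rewrite -(Tr_frob (n - i - 1)); congr Tr.
rewrite [(a i * _) ^+ q]exprMn mulrA [w ^+ q * _]mulrC [LHS]exprMn [LHS]mulrC; congr (_ * _).
rewrite -!exprM -[RHS]frob_ext; congr (_ ^+ _).
have -> : (2 * n = 1 + (2 * i + (1 + 2 * (n - i - 1))))%N.
  by have := ltn_ord i; lia.
by rewrite !expnD expn1 !mulnA.
Qed.

Definition tau (x : L) : F := odflt 0 [pick c | Tr x == c%:A].

Lemma tauE (x : L) : (tau x)%:A = Tr x.
Proof.
rewrite /tau; case: pickP => [c /eqP //|noc].
by have [c /eqP] := Tr_scalar x; rewrite noc.
Qed.

Lemma in_alg_inj : injective (fun c : F => c%:A : L).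
Proof. exact: (fmorph_inj (in_alg L)). Qed.

Definition sesqui (u w : finvect_type L) : F := tau ((u : L) * Lp ((w : L) ^+ q)).

Lemma sesquiE u w : (sesqui u w)%:A = Tr ((u : L) * Lp ((w : L) ^+ q)).
Proof. exact: tauE. Qed.

Lemma sesquiDl w : {morph sesqui^~ w : u v / u + v}.
Proof. by move=> u v; apply: in_alg_inj; rewrite scalerDl !sesquiE mulrDl TrD. Qed.

Lemma sesquiZl (x : F) u w : sesqui (x *: u) w = x * sesqui u w.
Proof. by apply: in_alg_inj; rewrite -scalerA !sesquiE -TrZ scalerAl. Qed.

Lemma sesquiDr u : {morph sesqui u : v w / v + w}.
Proof.
move=> v w; apply: in_alg_inj.
by rewrite scalerDl !sesquiE conjD_ext LpD mulrDr TrD.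
Qed.

Lemma sesquiZr (x : F) u w : sesqui u (x *: w) = x ^+ q * sesqui u w.
Proof.
by apply: in_alg_inj; rewrite -scalerA !sesquiE conj_scale LpZ -TrZ scalerAr.
Qed.

Definition pencil (v : F) (x : L) : L := v%:A * Ls x + Lp x.

Lemma pencil_linear (v : F) : linear (pencil v).
Proof.
move=> c x y; rewrite /pencil LsD LpD LsZ LpZ mulrDr scalerDr -scalerAr.
by rewrite addrACA.
Qed.

Definition kerdim (v : F) : nat := \dim (lker (linfun (pencil v))).

Lemma kerdim_le (v : F) : (kerdim v <= n)%N.
Proof. by rewrite -dimL dimvS // subvf. Qed.

Lemma mem_lker_pencil (v : F) (x : L) :
  (x \in lker (linfun (pencil v))) = (pencil v x == 0).
Proof.
(* [lfunE] evaluates [linfun] only on a bundled linear map, so [pencil v] is packed as one. *)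
pose g : {linear L -> L} :=
  HB.pack (pencil v) (GRing.isLinear.Build _ _ _ _ _ (pencil_linear v)).
by rewrite memv_ker (lfunE g).
Qed.

(** [Tr_adjoint] turns the conjugate term into [l^q Tr (u * Ls (w^q))]; factoring out [l] leaves
    [l^(q-1)] in front of [Ls]. *)
Lemma herm_partE (l : F) u w : l != 0 ->
  (herm_part q sesqui l u w)%:A =
    l *: Tr ((u : L) * pencil (l ^+ q.-1) ((w : L) ^+ q)).
Proof.
move=> l0; rewrite /herm_part scalerDl -!scalerA sesquiE exprMn -[(l ^+ q * _) *: _]scalerA.
have -> : (sesqui w u ^+ q)%:A = Tr ((u : L) * Ls ((w : L) ^+ q)) :> L.
  by rewrite -Tr_adjoint -sesquiE conj_scale expr1n.
rewrite /pencil mulrDr TrD scalerDr addrC mulrCA mulr_algl TrZ scalerA -exprS.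
by rewrite prednK // ltnW.
Qed.

Lemma conj_inj : injective (fun x : finvect_type L => x ^+ q).
Proof.
move=> x y; rewrite -{2}[x](@frob_ext x) -{2}[y](@frob_ext y) -(prednK n_gt0).
by rewrite mulnS expnD expnS -mulnA !(exprM _ q) => ->.
Qed.

(** By nondegeneracy of the trace, the radical is the preimage of the kernel under the bijection
    [w |-> w^q]. *)
Lemma card_radical_sesqui (l : F) : l != 0 ->
  #|radical (herm_part q sesqui l)| = (q ^ (2 * kerdim (l ^+ q.-1)))%N.
Proof.
move=> l0; rewrite expnM -cardF /kerdim; set U := lker _.
rewrite -(card_vspace (U : {vspace finvect_type L})) -[RHS]cardsE -[RHS](card_preimset _ conj_inj).
apply: eq_card => w; rewrite !inE mem_lker_pencil; apply/forallP/eqP => [rad_w|Lw0 u].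
  apply: Tr_nondegenerate => u; apply: (scalerI l0).
  by rewrite -(herm_partE u w l0) (eqP (rad_w u)) scale0r scaler0.
by apply/eqP/in_alg_inj; rewrite /= (herm_partE u w l0) Lw0 mulr0 Tr0 scaler0 scale0r.
Qed.

Lemma Ncount_sesqui (c : F) : Ncount q a c = #|[set u | sesqui u u + c == 0]|.
Proof.
apply: eq_card => u; rewrite !inE -[in RHS](inj_eq in_alg_inj) scale0r scalerDl.
by rewrite sesquiE.
Qed.

(** By [kerdim_le] the subtraction in [Rk] is not truncated, so the exponent is [2n - Rk], and
    [(-q)^(2n) = q^(2n)]. *)
Lemma sign_power_rank (v : F) :
  (- q%:R) ^+ (n + kerdim v)%N = q%:R ^+ (2 * n)%N * (- q%:R) ^- Rk q a v :> rat.
Proof.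
have q0 : - q%:R != 0 :> rat by rewrite oppr_eq0 pnatr_eq0 gtn_eqF // ltnW.
apply: (mulIf (expf_neq0 (Rk q a v) q0)); rewrite divfK ?expf_neq0 // -exprD /Rk -/(kerdim v).
by rewrite -addnA subnKC ?kerdim_le // addnn -mul2n exprM sqrrN -exprM.
Qed.

Lemma card_Ncount (c : F) :
  (Ncount q a c)%:R =
    q%:R ^+ (2 * (n - 1))%N * (1 + \sum_(v : F | v ^+ q.+1 == 1%R)
        (q%:R * ((c == 0%R) || (v == - (c / c ^+ q)))%:R - 1) * (- q%:R) ^- Rk q a v) :> rat.
Proof.
have q0 : q%:R != 0 :> rat by rewrite pnatr_eq0 gtn_eqF // ltnW.
apply: (mulfI (expf_neq0 2 q0)); rewrite Ncount_sesqui.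
rewrite (card_sesqui cardF conjD_base sesquiDl sesquiZl sesquiDr sesquiZr card_ext card_radical_sesqui).
rewrite mulrA -exprD mulrDr mulr1 -[X in (X + _)%N]muln1 -mulnDr subnKC //.
congr (_ + _); rewrite big_distrr; apply: eq_bigr => v _.
by rewrite sign_power_rank mulrCA.
Qed.

End FieldExtension.

(** * The two cases [c = 0] and [c != 0] *)

Theorem theorem4p1 (F : finFieldType) (L : fieldExtType F) (q n : nat)
  (a : 'I_n -> L) :
  (exists p k : nat, [/\ prime p, 0 < k & q = p ^ k])%N ->
  #|F| = (q ^ 2)%N ->
  (0 < n)%N ->
  \dim {: L} = n ->
  ((Ncount q a 0)%:R : rat) =
    (q%:R ^+ (2 * (n - 1)) + (q%:R - 1) * q%:R ^+ (2 * (n - 1)) *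
       \sum_(v : F | v ^+ q.+1 == 1) (- q%:R) ^- (Rk q a v))
  /\
  (forall c : F, c != 0 ->
    ((Ncount q a c)%:R : rat) =
      q%:R ^+ (2 * (n - 1))
      + q%:R ^+ (2 * n - 1) * (- q%:R) ^- (Rk q a (- (c / c ^+ q)))
      - q%:R ^+ (2 * (n - 1)) *
          \sum_(v : F | v ^+ q.+1 == 1) (- q%:R) ^- (Rk q a v)).
Proof.
case=> p [k [p_prime _ {q}->]] cardF n_gt0 dimL; split=> [|c c0];
  rewrite (card_Ncount a p_prime cardF n_gt0 dimL); set q := (p ^ k)%N in cardF *.
  by rewrite eqxx /= mulr1 -mulr_sumr mulrDr mulr1 mulrA [(_ - 1) * _]mulrC.
set v0 := - (c / c ^+ q).
(* Conjugation sends [v0] to [- c^q / c], its inverse. *)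
have v01 : v0 ^+ q.+1 == 1.
  rewrite exprS (conjN cardF (conjD_base p_prime cardF)) mulrNN expr_div_n (conjK cardF).
  by rewrite mulrA divfK ?divff ?expf_neq0.
(* Only [v = v0] carries the extra [q], and [q * q^(2(n-1)) = q^(2n-1)] gives the isolated term. *)
under eq_bigr => v _ do rewrite (negPf c0) /= mulrBl mul1r -mulrA.
rewrite sumrB -mulr_sumr /= (bigD1 v0) //= eqxx mul1r big1 ?addr0; last first.
  by move=> v /andP[_ /negPf->]; rewrite mul0r.
have -> : (2 * n - 1 = 2 * (n - 1) + 1)%N by lia.
by rewrite exprD expr1; ring.
Qed.
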